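(* Consider the planar system $$\dot x=y,\qquad \dot y=ax^{m}+bx^{n}y+y^2H(x,y)+\mathcal{O}(x^{m+1})+y\,\mathcal{O}(x^{n+1}),$$ with nilpotent node at the origin, satisfying: $m$ odd, $a<0$, $n$ even ($n\ge2$), $b\ne0$, and either $m>2n+1$, or $m=2n+1$ and $b^2+4a(n+1)\ge0$. Let $U=(U_1,U_2)$ be the unit-time map of the system near the origin. Then the characteristic map $C_h$ has the form $$C_h(x)=x+\frac a2x^m+\mathcal{O}(x^{m+1})$$ with characteristic box dimension $\dim_{ch}U=1-\frac1m$ if and only if the origin is an $m$-multiple nilpotent node.
   Context: The functions in the system are $C^\infty$; the terms $\mathcal{O}(x^{m+1})$ and $\mathcal{O}(x^{n+1})$ depend on $x$ alone; $H$ has zero infinite jet at the origin. The unit-time map of a system with flow $\phi_t$ is $\phi_1$. For a system $\dot x=y+A(x,y)$, $\dot y=B(x,y)$ with $A,B$ having zero $1$-jet at the origin, the characteristic curve is the curve $y=f(x)$ with $f(x)+A(x,f(x))=0$, $f(0)=0$ (here $f\equiv0$). With $F(x)=B(x,f(x))$, the origin is $m$-multiple (has order, or multiplicity, $m$) if $F(x)=cx^m+\mathcal{O}(x^{m+1})$ with $c\ne0$. The characteristic map is $C_h(x)=U_1(x,f(x))$. The characteristic box dimension is $\dim_{ch}U=\dim_BS_{ch}$, where $S_{ch}$ is an orbit of the one-dimensional discrete system generated by $C_h$ near $0$ and tending to $0$. Box dimension: for bounded $A\subset\mathbb{R}^N$ let $A_\varepsilon$ be its $\varepsilon$-neighborhood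 and $|A_\varepsilon|$ its Lebesgue measure. For $s\ge0$ put $\mathcal M_*^s(A)=\liminf_{\varepsilon\to0}|A_\varepsilon|/\varepsilon^{N-s}$ and $\mathcal M^{*s}(A)=\limsup_{\varepsilon\to0}|A_\varepsilon|/\varepsilon^{N-s}$. The lower and upper box dimensions are $\inf\{s>0:\mathcal M_*^s(A)=0\}$ and $\inf\{s>0:\mathcal M^{*s}(A)=0\}$; if equal, the common value is $\dim_BA$. *)

(* Defs.v *)
From mathcomp Require Import all_boot all_order all_algebra.
From mathcomp Require Import all_classical all_reals all_analysis.

Set Implicit Arguments.
Unset Strict Implicit.
Unset Printing Implicit Defensive.

Import Order.TTheory GRing.Theory Num.Theory.
Import numFieldNormedType.Exports.

Local Open Scope classical_set_scope.
Local Open Scope ring_scope.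

Section Smoothness.
Context {R : realType} {V W : normedModType R}.

Fixpoint iter_derive (vs : seq V) (f : V -> W) : V -> W :=
  if vs is v :: vs' then fun x => 'D_v (iter_derive vs' f) x else f.

(** For finite-dimensional [V] this is the usual notion of being C^infty on a
    neighbourhood of [x0]: all iterated partial derivatives exist and are
    continuous there. *)
Definition smooth_near (x0 : V) (f : V -> W) : Prop :=
  \forall x \near x0, forall vs : seq V,
    {for x, continuous (iter_derive vs f)} /\
    (forall v : V, derivable (iter_derive vs f) x v).

Definition zero_jet (x0 : V) (f : V -> W) : Prop :=
  forall vs : seq V, iter_derive vs f x0 = 0.

End Smoothness.

Section PlanarSystems.
Context {R : realType}.
Implicit Types (X : R * R -> R * R) (A B : R * R -> R) (U : R * R -> R * R).

(** The system x' = y + A(x,y), y' = B(x,y). *)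
Definition field_of A B : R * R -> R * R := fun p => (p.2 + A p, B p).

Definition is_solution X (I : set R) (g : R -> R * R) : Prop :=
  forall t, I t ->
    is_derive t 1 (fun u => (g u).1) (X (g t)).1 /\
    is_derive t 1 (fun u => (g u).2) (X (g t)).2.

(** [U] is the time-one map of the flow [phi], near the origin.  Solutions live
    on an open interval containing [0, 1] so that derivatives at the end points
    are two-sided.  The values of [U] far from the origin are irrelevant. *)
Definition unit_time_map X U : Prop :=
  exists phi : R -> R * R -> R * R,
    \forall p \near (0 : R * R),
      [/\ phi 0 p = p,
          exists2 e : R, 0 < e & is_solution X `]-e, 1 + e[ (phi ^~ p)
        & U p = phi 1 p].

Definition characteristic_curve A (f : R -> R) : Prop :=
  [/\ f 0 = 0, {for 0, continuous f}
    & \forall x \near 0, f x + A (x, f x) = 0].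

Definition origin_multiple B (f : R -> R) (m : nat) : Prop :=
  exists2 c : R, c != 0 &
    (fun x => B (x, f x)) = (fun x => c * x ^+ m) +O_ (0 : R) (fun x => x ^+ m.+1).

Definition nilpotent_singularity X : Prop :=
  [/\ X 0 = 0, differentiable X 0,
      exists p, 'd X 0 p != 0 & forall p, 'd X 0 ('d X 0 p) = 0].

(** Asymptotic stability, with every nearby orbit entering the origin along a
    well-defined tangent direction. *)
Definition attracting_node X : Prop :=
  forall N : set (R * R), nbhs (0 : R * R) N ->
    \forall p \near (0 : R * R), p != 0 ->
      exists g : R -> R * R,
        [/\ g 0 = p,
            exists2 e : R, 0 < e & is_solution X `]-e, +oo[ g,
            forall t, 0 <= t -> N (g t),
            g t @[t --> +oo] --> (0 : R * R)
          & cvg (`|g t|^-1 *: g t @[t --> +oo])].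

(** The second alternative is the repelling node (time reversal). *)
Definition nilpotent_node X : Prop :=
  nilpotent_singularity X /\ (attracting_node X \/ attracting_node (\- X)).

Definition characteristic_map U (f : R -> R) : R -> R := fun x => (U (x, f x)).1.

End PlanarSystems.

(** Minkowski contents and box dimension of subsets of the line (N = 1). *)
Section BoxDimension.
Context {R : realType}.
Implicit Types (S : set R) (s d e : R).

Definition eps_neighborhood S e : set R := \bigcup_(a in S) ball a e.

Definition content_ratio S s e : \bar R :=
  (lebesgue_measure (eps_neighborhood S e) * ((e `^ (1 - s))^-1)%:E)%E.

Definition lower_content s S : \bar R := limf_einf (content_ratio S s) 0^'+.
Definition upper_content s S : \bar R := limf_esup (content_ratio S s) 0^'+.

Definition lower_box_dim S : \bar R :=
  ereal_inf [set s%:E | s in [set s | 0 < s /\ lower_content s S = 0%E]].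
Definition upper_box_dim S : \bar R :=
  ereal_inf [set s%:E | s in [set s | 0 < s /\ upper_content s S = 0%E]].

Definition has_box_dim S d : Prop :=
  [/\ bounded_set S, lower_box_dim S = d%:E & upper_box_dim S = d%:E].

Definition orbit_set (C : R -> R) (x0 : R) : set R :=
  range (fun k : nat => iter k C x0).

(** Nontrivial orbit that stays within [r] of [0] and tends to [0]. *)
Definition orbit_to_zero (C : R -> R) (r x0 : R) : Prop :=
  [/\ x0 != 0, forall k, `|iter k C x0| < r & iter k C x0 @[k --> \oo] --> 0].

(** "The" box dimension of an orbit near 0 tending to 0: such orbits exist
    arbitrarily near 0, and all of them have dimension [d]. *)
Definition orbit_box_dim (C : R -> R) (d : R) : Prop :=
  \forall r \near 0^'+,
    (exists x0, orbit_to_zero C r x0) /\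
    (forall x0, orbit_to_zero C r x0 -> has_box_dim (orbit_set C x0) d).

Definition characteristic_box_dim (U : R * R -> R * R) (f : R -> R) d : Prop :=
  orbit_box_dim (characteristic_map U f) d.

End BoxDimension.

(** [r] and [s] are the O(x^(m+1)) and O(x^(n+1)) remainders. *)
Definition node_rhs {R : realType} (a b : R) (m n : nat)
    (H : R * R -> R) (r s : R -> R) : R * R -> R :=
  fun p => a * p.1 ^+ m + b * p.1 ^+ n * p.2 + p.2 ^+ 2 * H p
           + r p.1 + p.2 * s p.1.

(* Main.v *)
Require Import Defs.
From mathcomp Require Import all_boot all_order all_algebra.
From mathcomp Require Import all_classical all_reals all_analysis.
From mathcomp Require Import ring lra zify.
Import Order.TTheory GRing.Theory Num.Theory.
Import numFieldNormedType.Exports.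
Local Open Scope classical_set_scope.
Local Open Scope ring_scope.

(** Both sides of the equivalence hold.  Since the first equation is [x' = y],
    the characteristic curve is [y = 0] near the origin; there the second
    component of the field is [a x^m + r x], so the multiplicity is [m], and the
    node property is among the hypotheses.  The content is in the left-hand
    side: the expansion of the time-one map along [y = 0], and the dimension of
    the orbits of a one-dimensional map with that expansion.

    Expansion.  Near the origin the second component of the field differs from
    [a x^m] by [O(|x|^(m+1) + |y| (|x| + |y|))] ([node_rhs_expansion]).  A
    solution issued from [(x, 0)] with [|x| <= rho] satisfies [|y| <= D rho^m]
    on the time interval [0, 1]: as long as this holds, [y'] is smaller than
    [D rho^m], so the bound persists ([confinement]).  The first coordinate
    therefore moves by [O(rho^m)] only, the acceleration is
    [a x^m + O(rho^(m+1))], and integrating twice gives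
    [x + (a/2) x^m + O(rho^(m+1))] at time one ([time_one_expansion]).  The
    radius [rho] is kept independent of [x] so that the fixed point [x = 0] can
    be reached by letting [rho] tend to [0].

    Dimension.  For [m] odd and [a < 0] the distances [d_k] of an orbit to [0]
    have gaps [d_k - d_(k+1)] comparable to [d_k^m].  With [t = e^(1/m)], the
    points beyond [t] number [O(t^(1-m))], because [d_k^(1-m)] grows at least
    linearly in [k]; they contribute [O(e t^(1-m)) = O(t)] to the measure of the
    [e]-neighborhood.  The points within a small multiple of [t] are closer to
    each other than [e], so they fill an interval of length comparable to [t].
    Hence the [e]-neighborhood has measure comparable to [e^(1/m)]
    ([has_box_dim_decay]), and the dimension is [1 - 1/m]
    ([has_box_dim_measure]). *)

(** * Box dimension from the measure of neighborhoods *)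

Lemma limf_esup_le {T : choiceType} {X : filteredType T} {R : realType}
    (f : X -> \bar R) (F : set (set X)) (c : \bar R) :
  F [set x | f x <= c]%E -> (limf_esup f F <= c)%E.
Proof.
move=> Fc; rewrite limf_esupE;
  apply: (@le_trans _ _ (ereal_sup (f @` [set x | f x <= c]%E))).
  by apply: ereal_inf_lbound; exists [set x | f x <= c]%E.
by apply: ge_ereal_sup => _ [x fxc <-].
Qed.

Lemma le_limf_einf {T : choiceType} {X : filteredType T} {R : realType}
    (f : X -> \bar R) (F : set (set X)) (c : \bar R) :
  F [set x | c <= f x]%E -> (c <= limf_einf f F)%E.
Proof.
move=> Fc; rewrite /limf_einf leeNr; apply: limf_esup_le.
by congr (F _): Fc; apply/seteqP; split => x /=; rewrite leeN2.
Qed.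

Lemma limf_einf_le_esup {T : choiceType} {X : filteredType T} {R : realType}
    (f : X -> \bar R) (F : set (set X)) :
  ProperFilter F -> (limf_einf f F <= limf_esup f F)%E.
Proof.
move=> FF; rewrite limf_einfE limf_esupE.
apply: ge_ereal_sup => _ [V FV <-]; apply: le_ereal_inf_tmp => _ [W FW <-].
have [x [Vx Wx]] := filter_ex (filterI FV FW).
apply: (@le_trans _ _ (f x)).
  by apply: ereal_inf_lbound; exists x.
by apply: ereal_sup_ubound; exists x.
Qed.

(** The ratio measured by the content of exponent [s] is squeezed between
    multiples of [e^(s - d)], so both contents vanish for [s > d] and both are
    at least [c1] for [s <= d]: the two sets whose infima define the lower and
    upper dimensions are the same half-line. *)
Lemma has_box_dim_measure {R : realType} (S : set R) (d c1 c2 : R) :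
    bounded_set S -> 0 < d -> 0 < c1 ->
    (\forall e \near 0^'+,
      ((c1 * e `^ (1 - d))%:E <= lebesgue_measure (eps_neighborhood S e)
        <= (c2 * e `^ (1 - d))%:E)%E) ->
  has_box_dim S d.
Proof.
move=> Sb d0 c10 Hb.
have ratio_pow s e : 0 < e -> e `^ (1 - d) * (e `^ (1 - s))^-1 = e `^ (s - d).
  move=> e0; rewrite -powRN -powRD; last by rewrite (gt_eqF e0) implybT.
  by congr (_ `^ _); lra.
have lower_le_upper : forall s, (lower_content s S <= upper_content s S)%E.
  by move=> s; exact: limf_einf_le_esup.
have small : forall s, d < s ->
    lower_content s S = 0%E /\ upper_content s S = 0%E.
  move=> s ds.
  have lo : (0 <= lower_content s S)%E.
    by apply: le_limf_einf; near=> e;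
      rewrite /= /content_ratio mule_ge0// lee_fin invr_ge0 powR_ge0.
  have up : (upper_content s S <= 0)%E.
    apply/lee_addgt0Pr => eta eta0; rewrite add0e; apply: limf_esup_le.
    have e0 : 0 < eta / (`|c2| + 1) by rewrite divr_gt0// ltr_wpDl.
    have sd : 0 < s - d by lra.
    have /cvgrPdist_lt/(_ _ e0) powlt := powR_cvg0 sd.
    near=> e; rewrite /= /content_ratio.
    have egt0 : 0 < e by near: e; exact: nbhs_right_gt.
    have [|_ le_c2] := andP (near Hb e _) => //.
    apply: (le_trans (lee_wpmul2r _ le_c2));
      first by rewrite lee_fin invr_ge0 powR_ge0.
    rewrite -EFinM lee_fin -mulrA ratio_pow//.
    apply: (@le_trans _ _ ((`|c2| + 1) * e `^ (s - d))).
      by rewrite ler_wpM2r ?powR_ge0//; have := ler_norm c2; lra.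
    rewrite mulrC -ler_pdivlMr; last by rewrite ltr_wpDl.
    apply/ltW; have : `|0 - e `^ (s - d)| < eta / (`|c2| + 1) by near: e.
    by rewrite sub0r normrN ger0_norm ?powR_ge0.
  split; apply/eqP; rewrite eq_le; apply/andP; split => //.
  - exact: le_trans (lower_le_upper s) up.
  - exact: le_trans lo (lower_le_upper s).
have large : forall s, s <= d -> (c1%:E <= lower_content s S)%E.
  move=> s sd; apply: le_limf_einf; near=> e; rewrite /= /content_ratio.
  have e0 : 0 < e by near: e; exact: nbhs_right_gt.
  have [|ge_c1 _] := andP (near Hb e _) => //.
  apply: (le_trans _ (lee_wpmul2r _ ge_c1));
    last by rewrite lee_fin invr_ge0 powR_ge0.
  rewrite -EFinM lee_fin -mulrA ratio_pow// ler_peMr ?(ltW c10)//.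
  rewrite -(powRr0 e); apply: ger_powR; last by lra.
  by rewrite e0/=; near: e; apply: nbhs_right_le.
have inf_gt : ereal_inf [set s%:E | s in [set s | d < s]] = d%:E.
  apply/eqP; rewrite eq_le; apply/andP; split.
    apply/lee_addgt0Pr => eta eta0; apply: ereal_inf_lbound => /=.
    by exists (d + eta) => //=; lra.
  by apply: le_ereal_inf_tmp => _ [s /= ds <-]; rewrite lee_fin ltW.
split=> //; rewrite -[RHS]inf_gt; congr (ereal_inf (image _ _)).
- apply/seteqP; split => s /=; last by move=> ds; split;
  [exact: lt_trans ds|case: (small s ds)].
  case=> _ s0; rewrite ltNge; apply/negP => /large; rewrite s0 lee_fin.
  by rewrite leNgt c10.
- apply/seteqP; split => s /=; last by move=> ds; split;
  [exact: lt_trans ds|case: (small s ds)].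
  case=> _ s0; rewrite ltNge;
    apply/negP => /large/le_trans/(_ (lower_le_upper s)).
  by rewrite s0 lee_fin leNgt c10.
Unshelve. all: by end_near. Qed.

(** * Sequences whose gaps are comparable to a power of their terms *)

Lemma powR_invn_exp {R : realType} (m : nat) (e : R) :
  (0 < m)%N -> 0 <= e -> (e `^ m%:R^-1) ^+ m = e.
Proof.
move=> m0 e0; rewrite -powR_mulrn ?powR_ge0// -powRrM mulVf ?powRr1//.
by rewrite pnatr_eq0 -lt0n.
Qed.

Section PowerDecay.
Context {R : realType} (d : nat -> R) (p : nat) (c : R).
Hypotheses (p_gt0 : (0 < p)%N) (c_gt0 : 0 < c) (d_gt0 : forall k, 0 < d k).
Hypothesis gap_ge : forall k, c * d k ^+ p.+1 <= d k - d k.+1.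

Lemma decay_le k : d k.+1 <= d k.
Proof.
have := gap_ge k; have : 0 <= c * d k ^+ p.+1 by rewrite mulr_ge0 ?exprn_ge0
  ?ltW.
lra.
Qed.

Lemma decay_le0 k : d k <= d 0%N.
Proof. by elim: k => // k IH; exact: le_trans (decay_le k) IH. Qed.

(** A discrete form of [(x^(-p))' >= c p] for [x' <= - c x^(p+1)].  Bounding all
    but one factor of [d_(k+1)^p] by [d_k] gives
    [d_(k+1)^p <= d_k^p - c d_k^(2p)]; dividing by the product of both powers
    concludes. *)
Lemma inv_pow_decay k : (d k ^+ p)^-1 + c <= (d k.+1 ^+ p)^-1.
Proof.
have x0 := d_gt0 k; have y0 := d_gt0 k.+1; have yx := decay_le k.
have := gap_ge k; move: x0 y0 yx; set x := d k; set y := d k.+1 => x0 y0 yx gap.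
have xp0 : 0 < x ^+ p by rewrite exprn_gt0.
have yp0 : 0 < y ^+ p by rewrite exprn_gt0.
have ypxp : y ^+ p <= x ^+ p by rewrite lerXn2r// nnegrE ltW.
have key : y ^+ p <= x ^+ p - c * (x ^+ p * x ^+ p).
  apply: (@le_trans _ _ (y * x ^+ p.-1)).
    by rewrite -{1}(prednK p_gt0) exprS ler_wpM2l ?(ltW y0)// lerXn2r// nnegrE
      ltW.
  apply: (@le_trans _ _ ((x - c * x ^+ p.+1) * x ^+ p.-1)).
    by rewrite ler_wpM2r ?exprn_ge0 ?(ltW x0)//; lra.
  by rewrite mulrBl -exprS (prednK p_gt0) -!mulrA exprSr -mulrA -exprS (prednK
    p_gt0).
rewrite -(ler_pM2r yp0) mulVf ?(gt_eqF yp0)// -(ler_pM2l xp0) mulr1.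
rewrite mulrDl mulrDr mulrA mulfV ?(gt_eqF xp0)// mul1r mulrCA.
have : c * (x ^+ p * y ^+ p) <= c * (x ^+ p * x ^+ p).
  by rewrite ler_wpM2l ?(ltW c_gt0)// ler_wpM2l ?(ltW xp0).
lra.
Qed.

Lemma index_mul_pow_decay k : k%:R * c * d k ^+ p <= 1.
Proof.
have dp0 : 0 < d k ^+ p by rewrite exprn_gt0.
rewrite -ler_pdivlMr// mul1r.
elim: k {dp0} => [|k IH]; first by rewrite mul0r invr_ge0 exprn_ge0 ?ltW.
by rewrite -natr1 mulrDl mul1r; apply: le_trans (inv_pow_decay k);
  rewrite lerD2r.
Qed.

Lemma index_decay_gt k t : 0 < t -> t < d k -> k%:R <= (c * t ^+ p)^-1.
Proof.
move=> t0 tk; have ct0 : 0 < c * t ^+ p by rewrite mulr_gt0 ?exprn_gt0.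
rewrite -[leRHS]mul1r ler_pdivlMr// mulrA.
apply: le_trans (index_mul_pow_decay k);
  rewrite ler_wpM2l ?mulr_ge0 ?(ltW c_gt0)//.
by rewrite lerXn2r ?nnegrE ?(ltW t0) ?(ltW tk)// ltW.
Qed.

Lemma decay_eventually_le t :
  0 < t -> forall k, (Num.truncn (c * t ^+ p)^-1 < k)%N -> d k <= t.
Proof.
move=> t0 k Kk; rewrite leNgt; apply/negP => /(index_decay_gt k t t0).
apply/negP; rewrite -ltNge; apply: lt_le_trans (truncnS_gt _) _.
by rewrite ler_nat.
Qed.

Lemma decay_cvg0 : d @ \oo --> 0.
Proof.
apply/cvgrPdist_le => e e0; near=> k.
rewrite sub0r normrN gtr0_norm//; apply: decay_eventually_le => //.
by near: k; exact: nbhs_infty_gt.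
Unshelve. all: by end_near. Qed.

Context (C sigma : R).
Hypotheses (C_gt0 : 0 < C) (sigma_norm : `|sigma| = 1).
Hypothesis gap_le : forall k, d k - d k.+1 <= C * d k ^+ p.+1.
Hypothesis half_le : forall k, d k <= 2 * d k.+1.

Let S := range (fun k => sigma * d k).

Lemma sigma_dist x y : `|sigma * x - sigma * y| = `|x - y|.
Proof. by rewrite -mulrBr normrM sigma_norm mul1r. Qed.

(** Below [t] consecutive terms are less than [e] apart: a point [y < t] lies
    between two consecutive terms, the larger of which is at most [2 y].  The
    interval from [0] to [sigma * t] is presented as a ball so that the two
    signs need not be separated. *)
Lemma eps_neighborhood_core e t : 0 < e -> t <= d 0%N ->
    C * (2 * t) ^+ p.+1 <= e ->
  ball (sigma * (t / 2)) (t / 2) `<=` eps_neighborhood S e.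
Proof.
move=> e0 td0 te z; rewrite /ball/= => zt.
have ss : sigma * sigma = 1.
  by rewrite -expr2 -[sigma ^+ 2]ger0_norm ?sqr_ge0// normrX sigma_norm expr1n.
pose y := sigma * z; have zE : z = sigma * y by rewrite /y mulrA ss mul1r.
move: zt; rewrite zE sigma_dist => yt.
have {yt} [y0 yt] : 0 < y /\ y < t by move: yt; rewrite ltr_norml => /andP[];
  lra.
have Py : exists k, d k < y.
  exists (Num.truncn (c * (y / 2) ^+ p)^-1).+1.
  apply: (@le_lt_trans _ _ (y / 2)); last by lra.
  by apply: decay_eventually_le => //; lra.
case: (ex_minnP Py) => -[|k] dky kmin.
  by have := lt_trans dky yt; rewrite ltNge td0.
have ydk : y <= d k by rewrite leNgt; apply/negP => /kmin; rewrite ltnn.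
exists (sigma * d k); first by exists k.
rewrite /ball/= sigma_dist ger0_norm; last by lra.
apply: (@le_lt_trans _ _ (d k - d k.+1)); first by lra.
apply: le_lt_trans (gap_le k) _; apply: lt_le_trans te.
by rewrite ltr_pM2l// ltrXn2r// ?nnegrE; have := half_le k; have := d_gt0 k;
  lra.
Qed.

(** The terms of large index are below [t] and share one ball around [0], placed
    after the small balls around the first terms. *)
Let cover e t k :=
  if (k <= Num.truncn (c * t ^+ p)^-1)%N
  then ball (sigma * d k) e else ball 0 (t + e).

Lemma eps_neighborhood_cover e t : 0 < e -> 0 < t ->
  eps_neighborhood S e `<=`
    \big[setU/set0]_(k < (Num.truncn (c * t ^+ p)^-1).+2) cover e t k.
Proof.
move=> e0 t0 z [_ [k _ <-]] zk; rewrite -bigcup_mkord /cover.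
set K := Num.truncn _; have [kK|Kk] := leqP k K.
  by exists k; rewrite /= ?kK// ltnS leqW.
exists K.+1; rewrite /= ?ltnn// /ball/= sub0r normrN.
have := decay_eventually_le t t0 k Kk; move: zk; rewrite /ball/= => zk dk.
have : `|sigma * d k| = d k by rewrite normrM sigma_norm mul1r gtr0_norm.
have := ler_normB (sigma * d k) (sigma * d k - z); rewrite subKr; lra.
Qed.

(** The number of small balls is at most [1 / (c t^p) + 1], and
    [e / t^p = t]. *)
Lemma lebesgue_eps_neighborhood_le e t : 0 < e -> 0 < t -> e = t ^+ p.+1 ->
  (lebesgue_measure (eps_neighborhood S e)
     <= (2 * t / c + 4 * e + 2 * t)%:E)%E.
Proof.
move=> e0 t0 et.
apply: le_trans (content_subadditive (@lebesgue_measure R) _ _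
  (eps_neighborhood_cover e t e0 t0)) _.
- by move=> k _; rewrite /cover; case: ifP => _;
  exact: measurable_realfun.measurable_ball.
- apply: measurable_realfun.open_measurable; apply: bigcup_open => x _.
  exact: ball_open.
rewrite /cover; set K := Num.truncn _.
rewrite big_ord_recr /= ltnn lebesgue_measure_ball; last by lra.
under eq_bigr => k _ do
  rewrite -ltnS ltn_ord lebesgue_measure_ball ?(ltW e0)//.
rewrite sumEFin -EFinD lee_fin sumr_const card_ord !mulr2n -(mulr_natr _ K.+1).
have KB : K%:R <= (c * t ^+ p)^-1.
  by rewrite truncn_le invr_ge0 mulr_ge0 ?exprn_ge0 ?ltW.
have : e * K%:R <= t / c.
  apply: le_trans (_ : e * (c * t ^+ p)^-1 <= _).
    by rewrite ler_wpM2l ?(ltW e0).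
  have tp0 : t ^+ p != 0 by rewrite expf_neq0// gt_eqF.
  suff -> : e * (c * t ^+ p)^-1 = t / c by [].
  by rewrite et exprS invfM mulrCA mulfK// mulrC.
rewrite -natr1; lra.
Qed.

Lemma has_box_dim_decay : has_box_dim S (1 - p.+1%:R^-1).
Proof.
have p1 : 0 < 1 - p.+1%:R^-1 :> R.
  by rewrite subr_gt0 invf_lt1// ltr1n.
(* With this factor, [C * (2 * kap * t) ^+ p.+1 <= e] when [t ^+ p.+1 = e]. *)
pose kap := (1 + C * 2 ^+ p.+1)^-1.
have C2 : 0 < C * 2 ^+ p.+1 by rewrite mulr_gt0 ?exprn_gt0.
have kap0 : 0 < kap by rewrite invr_gt0; lra.
have kap1 : kap <= 1 by rewrite invf_le1; lra.
apply: (@has_box_dim_measure _ _ _ kap (2 / c + 6)) => //.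
  exists (d 0%N); split; first exact: num_real.
  move=> x dx _ [k _ <-]; rewrite /= normrM sigma_norm mul1r gtr0_norm//.
  exact: le_trans (decay_le0 k) (ltW dx).
near=> e; rewrite opprB addrC subrK.
have e0 : 0 < e by near: e; exact: nbhs_right_gt.
have e1 : e <= 1 by near: e; exact: nbhs_right_le.
set t := e `^ _.
have t0 : 0 < t by exact: powR_gt0.
have te : t ^+ p.+1 = e by rewrite powR_invn_exp// ltW.
have t1 : t <= 1.
  by rewrite -(@expr_le1 _ p.+1) ?te// ltW.
have et : e <= t by rewrite -te exprS ler_piMr ?(ltW t0)// exprn_ile1 ?(ltW t0).
apply/andP; split.
  have td0 : kap * t <= d 0%N.
    apply: (@le_trans _ _ t); first by rewrite ler_piMl ?(ltW t0).
    rewrite leNgt; apply/negP => dt.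
    have : d 0%N ^+ p.+1 < e by rewrite -te ltrXn2r// ?nnegrE ltW.
    apply/negP; rewrite -leNgt; near: e; apply: nbhs_right_le.
    by rewrite exprn_gt0.
  have kt : 0 < kap * t by rewrite mulr_gt0.
  have : (lebesgue_measure (ball (sigma * (kap * t / 2))%R (kap * t / 2)%R)
      <= lebesgue_measure (eps_neighborhood S e))%E.
    apply: le_measure; rewrite ?inE.
    - exact: measurable_realfun.measurable_ball.
    - apply: measurable_realfun.open_measurable; apply: bigcup_open => x _.
      exact: ball_open.
    - apply: eps_neighborhood_core => //.
      rewrite !exprMn te !mulrA -[leRHS]mul1r ler_pM2r//.
      apply: (@le_trans _ _ ((C * 2 ^+ p.+1) * kap)).
        by rewrite ler_pM2l// exprS ler_piMr ?(ltW kap0)// exprn_ile1 ?(ltW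
          kap0).
      by rewrite ler_pdivrMr ?mul1r; lra.
  rewrite lebesgue_measure_ball; last by lra.
  by rewrite -[_ / 2 *+ 2]mulr_natr divfK.
apply: le_trans (lebesgue_eps_neighborhood_le e t e0 t0 (esym te)) _.
have -> : (2 / c + 6) * t = 2 * t / c + 6 * t by rewrite mulrDl mulrAC.
by rewrite lee_fin; lra.
Unshelve. all: by end_near. Qed.

End PowerDecay.

(** * Orbits of a one-dimensional map near a weakly attracting fixed point *)

Section OneDimensionalMap.
Context {R : realType} (C : R -> R) (p : nat) (A K del : R).
Hypotheses (p_gt0 : (0 < p)%N) (p_even : ~~ odd p) (A_gt0 : 0 < A).
Hypothesis del_K : K * del <= A / 2.
Hypothesis del_half : 3 / 2 * A * del ^+ p <= 1 / 2.
Hypothesis C_expansion : forall x, `|x| < del ->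
  `|C x - (x - A * x ^+ p.+1)| <= K * `|x| ^+ p.+2.

(** Because [p.+1] is odd, conjugating by [x |-> - x] preserves the form of the
    expansion, so a point and its image can be measured by their distances to
    [0] along the half-line of direction [sigma]. *)
Lemma map_step sigma y : sigma = 1 \/ sigma = -1 -> 0 < y -> y < del ->
  [/\ A / 2 * y ^+ p.+1 <= y - sigma * C (sigma * y),
      y - sigma * C (sigma * y) <= 3 / 2 * A * y ^+ p.+1
    & y <= 2 * (sigma * C (sigma * y))].
Proof.
move=> s1 y0 yd; have A0 := A_gt0.
have ss : sigma * sigma = 1 by case: s1 => ->; rewrite ?mulrNN mul1r.
have sn : `|sigma| = 1 by case: s1 => ->; rewrite ?normrN normr1.
have sp : sigma ^+ p.+1 = sigma.
  by case: s1 => ->; rewrite ?expr1n// exprS -signr_odd (negbTE p_even) mulr1.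
have ny : `|sigma * y| = y by rewrite normrM sn mul1r gtr0_norm.
have := C_expansion (sigma * y); rewrite ny exprMn sp => /(_ yd).
rewrite -[X in X <= _ -> _]mul1r -[X in X * _ <= _ -> _]sn -normrM.
have -> : sigma * (C (sigma * y) - (sigma * y - A * (sigma * y ^+ p.+1)))
   = sigma * C (sigma * y) - (sigma * sigma) * (y - A * y ^+ p.+1) by ring.
rewrite ss mul1r ler_norml => /andP[lo up].
have yp0 : 0 < y ^+ p.+1 by rewrite exprn_gt0.
have Ky : K * y ^+ p.+2 <= A / 2 * y ^+ p.+1.
  have [K0|K0] := leP K 0.
    apply: (@le_trans _ _ 0); first by rewrite mulr_le0_ge0// exprn_ge0 ?ltW.
    by rewrite mulr_ge0 ?(ltW yp0)// divr_ge0 ?(ltW A_gt0).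
  rewrite exprS mulrA ler_pM2r//; apply: le_trans del_K.
  by rewrite ler_pM2l// ltW.
have yhalf : 3 / 2 * A * y ^+ p.+1 <= 1 / 2 * y.
  rewrite exprSr mulrA ler_pM2r//; apply: le_trans del_half.
  rewrite ler_pM2l; last by lra.
  by rewrite lerXn2r ?nnegrE ?(ltW y0) ?(ltW yd)// (le_trans (ltW y0) (ltW yd)).
split; lra.
Qed.

(** An orbit never reaches [0] nor changes sign, so up to the constant sign of
    [x0] it is a positive nonincreasing sequence. *)
Lemma orbit_abs x0 (x : nat -> R := fun k => Num.sg x0 * iter k C x0) :
    x0 != 0 -> `|x0| < del ->
  forall k, [/\ 0 < x k, x k <= `|x0| & iter k C x0 = Num.sg x0 * x k].
Proof.
move=> x00 xd.
have s1 : Num.sg x0 = 1 \/ Num.sg x0 = -1.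
  by rewrite /Num.sg (negbTE x00); case: ifP; [right|left].
have ss : Num.sg x0 * Num.sg x0 = 1 by case: s1 => ->; rewrite ?mulrNN mul1r.
have xE k : iter k C x0 = Num.sg x0 * x k by rewrite /x mulrA ss mul1r.
elim=> [|k [xk0 xkx0 _]].
  by rewrite /x /= -normrEsg normr_gt0 -numEsg.
have A0 := A_gt0; have [lo _ half] := map_step _ _ s1 xk0 (le_lt_trans xkx0 xd).
have x1 : x k.+1 = Num.sg x0 * C (Num.sg x0 * x k) by rewrite -xE.
have : 0 <= A / 2 * x k ^+ p.+1 by rewrite mulr_ge0 ?exprn_ge0 ?(ltW xk0)//;
  lra.
by split; [lra|lra|exact: xE].
Qed.

Lemma orbit_has_box_dim x0 : x0 != 0 -> `|x0| < del ->
  iter k C x0 @[k --> \oo] --> 0 /\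
  has_box_dim (orbit_set C x0) (1 - p.+1%:R^-1).
Proof.
move=> x00 xd; have orb := orbit_abs x0 x00 xd; have A0 := A_gt0.
set s := Num.sg x0 in orb; pose x k := s * iter k C x0.
have s1 : s = 1 \/ s = -1.
  by rewrite /s /Num.sg (negbTE x00); case: ifP; [right|left].
have sn : `|s| = 1 by case: s1 => ->; rewrite ?normrN normr1.
have x_gt0 k : 0 < x k by case: (orb k).
have xE k : iter k C x0 = s * x k by case: (orb k).
have step k : [/\ A / 2 * x k ^+ p.+1 <= x k - x k.+1,
    x k - x k.+1 <= 3 / 2 * A * x k ^+ p.+1 & x k <= 2 * x k.+1].
  have [_ xk _] := orb k; have xS : x k.+1 = s * C (s * x k) by rewrite -xE.
  by rewrite xS; apply: map_step => //; exact: le_lt_trans xk xd.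
have A2 : 0 < A / 2 by lra.
have gap k : A / 2 * x k ^+ p.+1 <= x k - x k.+1 by case: (step k).
have xF : (fun k => iter k C x0) = (fun k => s * x k) by exact/funext.
split.
  rewrite xF -[X in _ --> X](mulr0 s).
  by apply: cvgMl_tmp; exact: (decay_cvg0 x p _ p_gt0 A2 x_gt0 gap).
rewrite /orbit_set xF.
apply: (has_box_dim_decay x p _ p_gt0 A2 x_gt0 gap (3 / 2 * A)) => //.
- by lra.
- by move=> k; case: (step k).
- by move=> k; case: (step k).
Qed.

End OneDimensionalMap.

Lemma orbit_box_dim_of_expansion {R : realType} (C : R -> R) (m : nat)
    (alpha : R) :
    odd m -> (1 < m)%N -> alpha < 0 ->
    C = (fun x => x + alpha * x ^+ m) +O_ (0 : R) (fun x => x ^+ m.+1) ->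
  orbit_box_dim C (1 - m%:R^-1).
Proof.
move=> m_odd m1 al0 /eqaddOP/pinfty_ex_gt0 [K K0 CK].
case: m m_odd m1 CK => // p /= p_even p0; rewrite ltnS in p0.
move/nbhs_normP => [d0 /= d00 CK].
have A0 : 0 < - alpha by lra.
(* The third bound makes half of the leading term absorb the remainder, and the
   fourth makes one step keep at least half of the distance to [0]. *)
pose del := Num.min d0 (Num.min 1
  (Num.min (- alpha / 2 / K) ((3 * - alpha)^-1))).
have del0 : 0 < del.
  by rewrite !lt_min d00 ltr01 !divr_gt0//= invr_gt0 mulr_gt0.
have [dd0 d1 dK dA] : [/\ del <= d0, del <= 1, del <= - alpha / 2 / K
    & del <= (3 * - alpha)^-1].
  by apply/and4P; rewrite -!le_min.
have delK : K * del <= - alpha / 2 by rewrite mulrC -ler_pdivlMr.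
have delh : 3 / 2 * - alpha * del ^+ p <= 1 / 2.
  have : del ^+ p <= (3 * - alpha)^-1.
    apply: le_trans dA; rewrite -(prednK p0) exprS ler_piMr ?(ltW del0)//.
    by rewrite exprn_ile1 ?(ltW del0).
  rewrite -[X in _ <= X]mul1r ler_pdivlMr; last by lra.
  lra.
have Cexp x : `|x| < del ->
    `|C x - (x - - alpha * x ^+ p.+1)| <= K * `|x| ^+ p.+2.
  move=> xd; have := CK x; rewrite /= sub0r normrN => /(_ (lt_le_trans xd dd0)).
  by rewrite normrX mulNr opprK.
near=> r.
have r0 : 0 < r by near: r; exact: nbhs_right_gt.
have rd : r < del by near: r; exact: nbhs_right_lt.
split.
  exists (r / 2); have rn : `|r / 2| = r / 2 by rewrite ger0_norm//; lra.
  have x0 : r / 2 != 0 by rewrite gt_eqF//; lra.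
  have xd : `|r / 2| < del by rewrite rn; lra.
  split=> //; last by case: (orbit_has_box_dim C p _ K del p0 p_even A0 delK
    delh Cexp _ x0 xd).
  move=> k; have [y0 yk ->] := orbit_abs C p _ K del p_even A0 delK delh Cexp _
    x0 xd k.
  rewrite normrM normr_sg x0 mul1r gtr0_norm//; rewrite rn in yk; lra.
move=> x0 [x00 xr _].
have xd : `|x0| < del by exact: lt_trans (xr 0%N) rd.
by case: (orbit_has_box_dim C p _ K del p0 p_even A0 delK delh Cexp _ x00 xd).
Unshelve. all: by end_near. Qed.

(** * Solutions issued from the characteristic curve *)

Lemma norm_subrXX {R : realDomainType} (x y B : R) k : `|x| <= B -> `|y| <= B ->
  `|x ^+ k.+1 - y ^+ k.+1| <= k.+1%:R * B ^+ k * `|x - y|.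
Proof.
move=> xB yB; have B0 : 0 <= B by exact: le_trans xB.
elim: k => [|k IH]; first by rewrite !expr1 expr0 !mul1r.
rewrite [x ^+ k.+2]exprS [y ^+ k.+2]exprS.
have -> : x * x ^+ k.+1 - y * y ^+ k.+1
    = x * (x ^+ k.+1 - y ^+ k.+1) + y ^+ k.+1 * (x - y) by ring.
apply: le_trans (ler_normD _ _) _; rewrite !normrM normrX.
have -> : k.+2%:R * B ^+ k.+1 * `|x - y|
    = B * (k.+1%:R * B ^+ k * `|x - y|) + B ^+ k.+1 * `|x - y|.
  by rewrite -[k.+2]addn1 natrD exprS; ring.
apply: lerD; first by rewrite ler_pM.
by rewrite ler_wpM2r// lerXn2r ?nnegrE.
Qed.

Lemma mean_value_le {R : realType} (f df : R -> R) (t K : R) : 0 < t ->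
    (forall s, 0 <= s <= t -> is_derive s 1 f (df s)) ->
    (forall s, 0 < s < t -> `|df s| <= K) ->
  `|f t - f 0| <= K * t.
Proof.
move=> t0 fd dfK.
have [||c] := @MVT _ f df 0 t t0.
- by move=> s; rewrite in_itv /= => /andP[s0 st]; apply: fd; rewrite !ltW.
- apply: derivable_within_continuous => s; rewrite in_itv /= => st.
  exact: (@ex_derive _ _ _ _ _ _ _ (fd s st)).
by rewrite in_itv/= subr0 => ct ->;
  rewrite normrM (gtr0_norm t0) ler_pM2r// dfK.
Qed.

(** The bound cannot fail at the infimum of the times where it fails: it holds
    before this time, hence at it, hence slightly after it by continuity. *)
Lemma continuation_lt1 {R : realType} (h : R -> R) :
    (forall t, 0 <= t <= 1 -> {for t, continuous h}) -> h 0 < 1 ->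
    (forall t, 0 < t <= 1 -> (forall s, 0 <= s < t -> h s < 1) -> h t < 1) ->
  forall t, 0 <= t <= 1 -> h t < 1.
Proof.
move=> hc h0 step t1 /andP[t10 t11]; rewrite ltNge; apply/negP => ht1.
pose Z := [set t | 0 <= t <= 1 /\ 1 <= h t].
have Zinf : has_inf Z.
  by split; [exists t1; split=> //; rewrite t10|exists 0 => s [/andP[]]].
have Zlb s : Z s -> inf Z <= s by apply: inf_lbound; case: Zinf.
have i0 : 0 <= inf Z by apply: lb_le_inf; [case: Zinf|move=> s [/andP[]]].
have i1 : inf Z <= 1 by apply: le_trans (Zlb t1 _) _ => //; split; rewrite ?t10.
have below s : 0 <= s < inf Z -> h s < 1.
  move=> /andP[s0 si]; rewrite ltNge; apply/negP => hs.
  have /Zlb : Z s by split=> //; rewrite s0 (ltW (lt_le_trans si i1)).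
  by rewrite leNgt si.
have hi : h (inf Z) < 1.
  move: i0; rewrite le_eqVlt => /predU1P[<-//|i0].
  by apply: step => //; rewrite i0.
have ci : {for inf Z, continuous h} by apply: hc; rewrite i0.
have /nbhs_normP [e /= e0 he] : \forall s \near inf Z, h s < 1.
  by apply: (cvgr_lt _ ci).
have [s Zs si] := inf_adherent e0 Zinf.
have : h s < 1.
  apply: he; rewrite /= ler0_norm; last by rewrite subr_le0 Zlb.
  by lra.
by case: Zs => _; rewrite leNgt => /negP.
Qed.

(** While the solution stays in the box of radii [rho] and [D rho^(m+1)] around
    [(x, 0)], its second coordinate has speed at most [M rho^(m+1)] with [M < D]
    and its first at most [D rho^(m+1) <= rho / 2], so by the mean value theorem
    it is still strictly inside; [continuation_lt1] applies to the gauge of the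
    box. *)
Lemma confinement {R : realType} (G : R * R -> R) (M D x rho : R) (m : nat)
    (u v : R -> R) :
    0 < rho -> 0 < D -> `|x| <= rho -> 2 * D * rho ^+ m.+1 <= rho ->
    (forall p, `|p.1| <= 2 * rho -> `|p.2| <= D * rho ^+ m.+1 ->
       `|G p| <= M * rho ^+ m.+1) -> M < D ->
    u 0 = x -> v 0 = 0 ->
    (forall t : R, 0 <= t <= 1 ->
       is_derive t 1 u (v t) /\ is_derive t 1 v (G (u t, v t))) ->
  forall t : R, 0 <= t <= 1 -> `|u t - x| < rho /\ `|v t| < D * rho ^+ m.+1.
Proof.
move=> rho0 D0 xr Dr GM MD u0 v0 sol.
have q0 : 0 < rho ^+ m.+1 by rewrite exprn_gt0.
have Dq0 : 0 < D * rho ^+ m.+1 by rewrite mulr_gt0.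
pose h t := Num.max (`|u t - x| / rho) (`|v t| / (D * rho ^+ m.+1)).
have hE t : (h t < 1) = (`|u t - x| < rho) && (`|v t| < D * rho ^+ m.+1).
  by rewrite /h gt_max !ltr_pdivrMr// !mul1r.
suff H : forall t : R, 0 <= t <= 1 -> h t < 1 by move=> t /H;
  rewrite hE => /andP.
apply: continuation_lt1.
- move=> t /sol[du dv].
  have cu : {for t, continuous u}.
    by apply: differentiable_continuous; apply/derivable1_diffP;
      exact: (@ex_derive _ _ _ _ _ _ _ du).
  have cv : {for t, continuous v}.
    by apply: differentiable_continuous; apply/derivable1_diffP;
      exact: (@ex_derive _ _ _ _ _ _ _ dv).
  apply: (@continuous_max _ _ (fun t => `|u t - x| / rho) (fun t => `|v t| / (D
    * rho ^+ m.+1))).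
    apply: cvgMr_tmp; apply: cvg_norm; apply: cvgB => //; exact: cvg_cst.
  by apply: cvgMr_tmp; apply: cvg_norm.
- by rewrite hE u0 v0 subrr normr0 rho0.
move=> t /andP[t0 t1] hlt; rewrite hE.
have inbox s : 0 <= s < t -> `|u s - x| < rho /\ `|v s| < D * rho ^+ m.+1.
  by move=> /hlt; rewrite hE => /andP.
have sol_t s : 0 <= s <= t -> is_derive s 1 u (v s) /\ is_derive s 1 v (G (u s,
  v s)).
  by move=> /andP[s0 st]; apply: sol; rewrite s0 (le_trans st).
have du : `|u t - u 0| <= D * rho ^+ m.+1 * t.
  apply: (mean_value_le u v t) => // [s /sol_t[]//|s /andP[s0 st]].
  by apply/ltW; case: (inbox s); rewrite ?(ltW s0) ?st.
have dv : `|v t - v 0| <= M * rho ^+ m.+1 * t.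
  apply: (mean_value_le v (fun s => G (u s, v s)) t) => // [s /sol_t[]//|s
    /andP[s0 st]].
  have [us vs] : `|u s - x| < rho /\ `|v s| < D * rho ^+ m.+1.
    by apply: inbox; rewrite (ltW s0).
  apply: GM; rewrite /= ?(ltW vs)//.
  have := ler_normD (u s - x) x; rewrite subrK; lra.
move: du dv; rewrite u0 v0 subr0 => du dv; apply/andP; split.
  apply: le_lt_trans du _; apply: (@le_lt_trans _ _ (D * rho ^+ m.+1)).
    by rewrite ler_piMr// ltW.
  lra.
have M0 : 0 <= M * rho ^+ m.+1.
  by apply: le_trans (GM (0, 0) _ _);
    rewrite ?normr0 ?(ltW Dq0) ?mulr_ge0 ?(ltW rho0).
apply: le_lt_trans dv _; apply: (@le_lt_trans _ _ (M * rho ^+ m.+1)).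
  by rewrite ler_piMr.
by rewrite ltr_pM2r.
Qed.

(** By [confinement] the acceleration along the solution is
    [a x^(m+1) + O(rho^(m+2))]; integrate it twice from zero velocity.  The
    estimate is in [rho] and not in [|x|] because for [x = 0] a box of positive
    size is still needed. *)
Lemma time_one_expansion {R : realType} (G : R * R -> R) (a K del : R)
    (m : nat) :
    0 < del -> 0 <= K -> (0 < m)%N ->
    (forall p, `|p.1| < del -> `|p.2| < del ->
       `|G p - a * p.1 ^+ m.+1|
         <= K * (`|p.1| ^+ m.+2 + `|p.2| * (`|p.1| + `|p.2|))) ->
  exists2 E, 0 <= E & \forall rho \near 0^'+, forall x (u v : R -> R),
    `|x| <= rho -> u 0 = x -> v 0 = 0 ->
    (forall t : R, 0 <= t <= 1 ->
       is_derive t 1 u (v t) /\ is_derive t 1 v (G (u t, v t))) ->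
  `|u 1 - (x + a / 2 * x ^+ m.+1)| <= E * rho ^+ m.+2.
Proof.
move=> del0 K0 m0 GK.
(* Any number above the coefficient of [rho ^+ m.+1] in the bound of
   [a * p.1 ^+ m.+1] on the box would do. *)
pose D := `|a| * 2 ^+ m.+1 + 1.
have aD : 0 <= `|a| * 2 ^+ m.+1 by rewrite mulr_ge0 ?exprn_ge0.
have D0 : 0 < D by rewrite /D; lra.
pose M := K * (2 ^+ m.+2 + D * 3).
have M0 : 0 <= M by rewrite mulr_ge0// addr_ge0 ?exprn_ge0// mulr_ge0// ltW.
pose E0 := `|a| * (m.+1%:R * 2 ^+ m * D).
have E00 : 0 <= E0 by rewrite !mulr_ge0 ?exprn_ge0// ltW.
exists (E0 + M); first by rewrite addr_ge0.
near=> rho => x u v xr u0 v0 sol.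
have rho0 : 0 < rho by near: rho; exact: nbhs_right_gt.
have rho1 : rho <= 1 by near: rho; exact: nbhs_right_le.
have rhod : rho < del / 2 by near: rho; apply: nbhs_right_lt; lra.
have rhoD : rho <= (2 * D)^-1.
  by near: rho; apply: nbhs_right_le; rewrite invr_gt0; lra.
have rhoM : rho <= (2 * (M + 1))^-1.
  by near: rho; apply: nbhs_right_le; rewrite invr_gt0; lra.
have q0 : 0 < rho ^+ m.+1 by rewrite exprn_gt0.
have Dq : 2 * D * rho ^+ m.+1 <= rho.
  rewrite exprS mulrCA ler_piMr ?(ltW rho0)//.
  rewrite mulrC -ler_pdivlMr ?mul1r; last by lra.
  apply: le_trans rhoD; rewrite -(prednK m0) exprS ler_piMr ?(ltW rho0)//.
  by rewrite exprn_ile1 ?(ltW rho0).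
have GM p : `|p.1| <= 2 * rho -> `|p.2| <= D * rho ^+ m.+1 ->
    `|G p - a * p.1 ^+ m.+1| <= M * rho ^+ m.+2.
  move=> p1 p2; apply: le_trans (GK p _ _) _; [lra|lra|].
  rewrite /M -mulrA ler_wpM2l// mulrDl; apply: lerD.
    by rewrite -exprMn lerXn2r ?nnegrE ?mulr_ge0// ltW.
  have -> : D * 3 * rho ^+ m.+2 = D * rho ^+ m.+1 * (3 * rho).
    by rewrite [rho ^+ m.+2]exprSr; ring.
  by rewrite ler_pM ?addr_ge0//; lra.
have conf : forall t : R, 0 <= t <= 1 -> `|u t - x| < rho /\ `|v t| < D * rho
  ^+ m.+1.
  apply: (@confinement _ G (`|a| * 2 ^+ m.+1 + 1 / 2) D x rho m u v) => //.
    move=> p p1 p2; have := GM p p1 p2 => Gp.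
    apply: (@le_trans _ _ (`|a * p.1 ^+ m.+1| + M * rho ^+ m.+2)).
      by have := ler_normD (G p - a * p.1 ^+ m.+1) (a * p.1 ^+ m.+1);
        rewrite subrK; lra.
    rewrite mulrDl; apply: lerD.
      rewrite normrM normrX -mulrA ler_wpM2l// -exprMn lerXn2r ?nnegrE//.
      by rewrite mulr_ge0// ltW.
    rewrite exprS mulrA ler_pM2r//.
    have : (M + 1) * rho <= 1 / 2.
      rewrite mulrC -ler_pdivlMr; last by lra.
      by apply: le_trans rhoM _; rewrite invfM; lra.
    lra.
  by rewrite /D; lra.
have ux t : 0 < t <= 1 -> `|u t - x| <= D * rho ^+ m.+1.
  move=> /andP[t0 t1]; rewrite -u0.
  apply: (@le_trans _ _ (D * rho ^+ m.+1 * t)); last first.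
    by rewrite ler_piMr// mulr_ge0 ?ltW.
  apply: (mean_value_le u v t) => // s /andP[s0 st].
    by case: (sol s) => //; rewrite s0 (le_trans st).
  by case: (conf s) => [|_ /ltW//]; rewrite (ltW s0) (le_trans (ltW st)).
have acc t : 0 < t <= 1 ->
    `|G (u t, v t) - a * x ^+ m.+1| <= (E0 + M) * rho ^+ m.+2.
  move=> t01; have [t0 t1] := andP t01.
  have [utx vt] : `|u t - x| < rho /\ `|v t| < D * rho ^+ m.+1.
    by apply: conf; rewrite (ltW t0).
  have ut : `|u t| <= 2 * rho.
    by have := ler_normD (u t - x) x; rewrite subrK; lra.
  have -> : G (u t, v t) - a * x ^+ m.+1 =
    a * (u t ^+ m.+1 - x ^+ m.+1) + (G (u t, v t) - a * u t ^+ m.+1) by ring.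
  apply: le_trans (ler_normD _ _) _; rewrite mulrDl; apply: lerD; last first.
    by apply: GM => //=; exact: ltW.
  rewrite normrM /E0 -mulrA ler_wpM2l//.
  apply: le_trans (norm_subrXX _ _ (2 * rho) m ut _) _; first by lra.
  apply: (@le_trans _ _ (m.+1%:R * (2 * rho) ^+ m * (D * rho ^+ m.+1))).
    by rewrite ler_wpM2l ?ux// mulr_ge0// exprn_ge0// mulr_ge0// ltW.
  rewrite exprMn.
  have -> : m.+1%:R * (2 ^+ m * rho ^+ m) * (D * rho ^+ m.+1)
    = m.+1%:R * 2 ^+ m * D * (rho ^+ m * rho ^+ m.+1) by ring.
  rewrite ler_wpM2l//; first by rewrite !mulr_ge0 ?exprn_ge0// ltW.
  rewrite [leRHS]exprS ler_pM2r// -(prednK m0) exprS ler_piMr ?(ltW rho0)//.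
  by rewrite exprn_ile1// ltW.
have Eq0 : 0 <= (E0 + M) * rho ^+ m.+2 by rewrite mulr_ge0 ?addr_ge0
  ?exprn_ge0// ltW.
have vt t : 0 < t <= 1 ->
    `|v t - a * x ^+ m.+1 * t| <= (E0 + M) * rho ^+ m.+2.
  move=> /andP[t0 t1].
  have := @mean_value_le _ (fun s => v s - a * x ^+ m.+1 * s)
    (fun s => G (u s, v s) - a * x ^+ m.+1) t ((E0 + M) * rho ^+ m.+2) t0.
  rewrite v0 mulr0 !subr0 => H; apply: le_trans (H _ _) _.
  - move=> s /andP[s0 st];
    have [_ dv] : is_derive s 1 u (v s) /\ is_derive s 1 v (G (u s, v s)).
      by apply: sol; rewrite s0 (le_trans st).
    by apply: is_deriveB => //; apply: is_derive_eq;
      rewrite /GRing.scale/= mulr1.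
  - by move=> s /andP[s0 st]; apply: acc; rewrite s0 (le_trans (ltW st)).
  by rewrite ler_piMr.
have := @mean_value_le _ (fun s => u s - a / 2 * x ^+ m.+1 * s ^+ 2)
    (fun s => v s - a * x ^+ m.+1 * s) 1 ((E0 + M) * rho ^+ m.+2) ltr01.
rewrite u0 expr0n /= mulr0 subr0 expr1n !mulr1 => H.
rewrite opprD addrA addrAC; apply: H => s /andP[s0 s1].
  have [du _] : is_derive s 1 u (v s) /\ is_derive s 1 v (G (u s, v s)).
    by apply: sol; rewrite s0.
  apply: is_deriveB => //; apply: is_derive_eq; rewrite /GRing.scale/=.
  by field.
by apply: vt; rewrite s0 ltW.
Unshelve. all: by end_near. Qed.

(** * The characteristic map of the system *)

Lemma node_rhs_expansion {R : realType} (a b : R) (m n : nat)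
    (H : R * R -> R) (r s : R -> R) :
    (0 < n)%N -> {for 0, continuous H} ->
    r =O_ (0 : R) (fun x => x ^+ m.+1) -> s =O_ (0 : R) (fun x => x ^+ n.+1) ->
  exists K, exists del, [/\ 0 <= K, 0 < del & forall p,
    `|p.1| < del -> `|p.2| < del ->
    `|node_rhs a b m n H r s p - a * p.1 ^+ m|
      <= K * (`|p.1| ^+ m.+1 + `|p.2| * (`|p.1| + `|p.2|))].
Proof.
move=> n0 Hc /eqOP/pinfty_ex_gt0[Kr Kr0 /nbhs_normP[dr /= dr0 rK]].
move=> /eqOP/pinfty_ex_gt0[Ks Ks0 /nbhs_normP[ds /= ds0 sK]].
have /nbhs_ballP[dh /= dh0 HK] : \forall p \near (0 : R * R), `|H p| < `|H 0| +
  1.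
  by apply: (cvgr_lt _ (cvg_norm Hc)); rewrite ltrDl.
exists (Kr + `|b| + (`|H 0| + 1) + Ks), (Num.min (Num.min dr ds) (Num.min dh
  1)).
split; first by rewrite !addr_ge0// ltW.
  by rewrite !lt_min dr0 ds0 dh0 ltr01.
move=> [x y] /=; rewrite !lt_min => /andP[/andP[xr xs] /andP[xh x1]].
move=> /andP[_ /andP[yh _]].
have rx : `|r x| <= Kr * `|x| ^+ m.+1.
  by have := rK x; rewrite /= sub0r normrN normrX; apply.
have xk k : (0 < k)%N -> `|x| ^+ k <= `|x|.
  by move=> k0; rewrite -(prednK k0) exprS ler_piMr// exprn_ile1// ltW.
have sx : `|s x| <= Ks * `|x|.
  have := sK x; rewrite /= sub0r normrN normrX => /(_ xs)/le_trans; apply.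
  by rewrite ler_pM2l// xk.
have Hp : `|H (x, y)| <= `|H 0| + 1.
  by apply/ltW/HK; split; rewrite /ball/= sub0r normrN.
have -> : node_rhs a b m n H r s (x, y) - a * x ^+ m
  = r x + y * (b * x ^+ n) + y * (y * H (x, y)) + y * s x.
  by rewrite /node_rhs/=; ring.
have t1 : `|y * (b * x ^+ n)| <= `|y| * (`|b| * `|x|).
  by rewrite !normrM normrX !ler_wpM2l// xk.
have t2 : `|y * (y * H (x, y))| <= `|y| * ((`|H 0| + 1) * `|y|).
  by rewrite !normrM ler_wpM2l// mulrC ler_wpM2r.
have t3 : `|y * s x| <= `|y| * (Ks * `|x|) by rewrite normrM ler_wpM2l.
apply: le_trans (ler_normD _ _) _.
apply: le_trans (lerD (ler_normD _ _) t3) _.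
apply: le_trans (lerD (lerD (ler_normD _ _) t2) (lexx _)) _.
apply: le_trans (lerD (lerD (lerD rx t1) (lexx _)) (lexx _)) _.
set X := `|x| in rx xk sx t1 t2 t3 *; set Y := `|y| in t1 t2 t3 *.
set Hb := `|H 0| + 1; have Hb0 : 0 <= Hb by rewrite addr_ge0.
have X0 : 0 <= X by exact: normr_ge0.
have Y0 : 0 <= Y by exact: normr_ge0.
have b0 : 0 <= `|b| by exact: normr_ge0.
have q0 : 0 <= X ^+ m.+1 by exact: exprn_ge0.
rewrite -subr_ge0.
have -> : (Kr + `|b| + Hb + Ks) * (X ^+ m.+1 + Y * (X + Y)) -
  (Kr * X ^+ m.+1 + Y * (`|b| * X) + Y * (Hb * Y) + Y * (Ks * X))
  = (`|b| + Hb + Ks) * X ^+ m.+1 + Kr * (Y * (X + Y)) + (`|b| + Ks) * (Y * Y)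
    + Hb * (Y * X) by ring.
by rewrite !(addr_ge0, mulr_ge0)// ltW.
Qed.

Lemma characteristic_map_expansion {R : realType} (a K del : R) (m : nat)
    (B : R * R -> R) (U : R * R -> R * R) (f : R -> R) :
    0 < del -> 0 <= K -> (1 < m)%N ->
    (forall p, `|p.1| < del -> `|p.2| < del ->
       `|B p - a * p.1 ^+ m| <= K * (`|p.1| ^+ m.+1 + `|p.2| * (`|p.1| +
         `|p.2|))) ->
    unit_time_map (field_of (fun=> 0) B) U ->
    (\forall x \near 0, f x = 0) ->
  characteristic_map U f = (fun x => x + a / 2 * x ^+ m) +O_ (0 : R) (fun x =>
    x ^+ m.+1).
Proof.
case: m => [//|m] del0 K0 m0 BK [phi /nbhs_ballP[d /= d0 phiP]] f0;
  rewrite ltnS in m0.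
have [E E0 /nbhs_normP[e /= e0 EP]] := @time_one_expansion _ B a K del m del0
  K0 m0 BK.
have EU x rho : `|x| < d -> f x = 0 -> 0 < rho -> rho < e -> `|x| <= rho ->
    `|characteristic_map U f x - (x + a / 2 * x ^+ m.+1)| <= E * rho ^+ m.+2.
  move=> xd fx rho0 rhoe xrho; rewrite /characteristic_map fx.
  have [|phi0 [eps eps0 sol] ->] := phiP (x, 0).
    by split; rewrite /ball/= sub0r normrN// normr0.
  apply: (EP rho _ rho0 x (fun t => (phi t (x, 0)).1) (fun t => (phi t (x,
    0)).2)) => //.
  - by rewrite /= sub0r normrN gtr0_norm.
  - by rewrite phi0.
  - by rewrite phi0.
  move=> t /andP[t0 t1].
  have [|du dv] := sol t; first by rewrite /= in_itv /=; apply/andP; split; lra.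
  by move: du dv; rewrite /field_of/= addr0 -surjective_pairing.
apply/eqaddOP; near=> k; near=> x.
have kE : E <= k by near: k; exact: nbhs_pinfty_ge (num_real _).
have fx : f x = 0 by near: x.
have xd : `|x| < d by near: x; exact: (@nbhs0_lt R R d d0).
have xe : `|x| < e by near: x; exact: (@nbhs0_lt R R e e0).
rewrite normrX.
have [x0|x0] := eqVneq x 0; last first.
  apply: (@le_trans _ _ (E * `|x| ^+ m.+2)).
    by apply: EU; rewrite ?normr_gt0.
  by rewrite ler_wpM2r ?exprn_ge0.
(* At [x = 0] the bound must be [0]: let the size of the box tend to [0]. *)
rewrite {2}x0 normr0 expr0n /= mulr0; apply/ler_addgt0Pr => eta eta0;
  rewrite add0r.
near (0 : R)^'+ => rho.
have rho0 : 0 < rho by near: rho; exact: nbhs_right_gt.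
have rho1 : rho <= 1 by near: rho; exact: nbhs_right_le.
have rhoe : rho < e by near: rho; exact: nbhs_right_lt.
apply: (@le_trans _ _ (E * rho ^+ m.+2)).
  by apply: EU => //; rewrite x0 normr0 ltW.
apply: (@le_trans _ _ ((E + 1) * rho)).
  rewrite ler_pM ?exprn_ge0 ?(ltW rho0)//; first by lra.
  by rewrite exprS ler_piMr ?(ltW rho0)// exprn_ile1// ltW.
rewrite mulrC -ler_pdivlMr; last by lra.
by near: rho; apply: nbhs_right_le; rewrite divr_gt0//; lra.
Unshelve. all: by end_near. Qed.

Theorem proposition2 (R : realType) (a b : R) (m n : nat)
    (H : R * R -> R) (r s : R -> R) (U : R * R -> R * R) (f : R -> R)
    (A := (fun _ => 0) : R * R -> R)
    (B := node_rhs a b m n H r s)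
    (X := field_of A B)
    (m_odd : odd m) (a_lt0 : a < 0)
    (n_even : ~~ odd n) (n_ge2 : (2 <= n)%N) (b_neq0 : b != 0)
    (mn : (2 * n + 1 < m)%N \/
          m = (2 * n + 1)%N /\ 0 <= b ^+ 2 + 4 * a * (n%:R + 1))
    (H_smooth : smooth_near 0 H) (H_flat : zero_jet 0 H)
    (r_smooth : smooth_near 0 r) (r_O : r =O_ (0 : R) (fun x => x ^+ m.+1))
    (s_smooth : smooth_near 0 s) (s_O : s =O_ (0 : R) (fun x => x ^+ n.+1))
    (X_node : nilpotent_node X)
    (U_map : unit_time_map X U)
    (f_curve : characteristic_curve A f) :
  (characteristic_map U f
     = (fun x => x + a / 2 * x ^+ m) +O_ (0 : R) (fun x => x ^+ m.+1)
   /\ characteristic_box_dim U f (1 - m%:R^-1))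
  <->
  (origin_multiple B f m /\ nilpotent_node X).
Proof.
have m1 : (1 < m)%N by lia.
have n0 : (0 < n)%N by lia.
have f0 : \forall x \near 0, f x = 0.
  by have [_ _] := f_curve; apply: filterS => x; rewrite /A addr0.
have Hc : {for 0, continuous H}.
  by case: (nbhs_singleton H_smooth [::]).
have [K [del [K0 del0 BK]]] := node_rhs_expansion a b m n H r s n0 Hc r_O s_O.
have C_exp : characteristic_map U f
     = (fun x => x + a / 2 * x ^+ m) +O_ (0 : R) (fun x => x ^+ m.+1).
  exact: (@characteristic_map_expansion _ a K del m B U f).
split=> _; split=> //.
  exists a; first by rewrite lt_eqF.
  move/eqOP: r_O => r_O; apply/eqaddOP; near=> k.
  have rk : \forall x \near 0, `|r x| <= k * `|x ^+ m.+1| by near: k.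
  apply: filterS2 rk f0 => x rx fx; rewrite !fctE /B /node_rhs /= fx.
  by rewrite mulr0 expr0n /= !mul0r !addr0 addrAC subrr add0r.
apply: (@orbit_box_dim_of_expansion _ _ m (a / 2)) => //; lra.
Unshelve. all: by end_near. Qed.
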